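(* Let $\mathcal{H}_1$ and $\mathcal{H}_2$ be weighted Hardy spaces in $d$ variables, with generating functions $G_1(t)=\sum_{n=0}^\infty a_nt^n$ and $G_2(t)=\sum_{n=0}^\infty b_nt^n$ respectively. If there exist $C,c,\gamma\in(0,\infty)$ such that $c\le\frac{b_n}{a_n}\gamma^n\le C$ for all $n$, then $\mathcal{H}_1$ and $\mathcal{H}_2$ are isomorphic via an RKHS isomorphism.
   Context: For $d\in\mathbb{N}$ and $r\in(0,\infty]$ let $r\mathbb{B}_d=\{z\in\mathbb{C}^d:|z|<r\}$ and $\overline{r\mathbb{B}_d}=\{z\in\mathbb{C}^d:|z|\le r\}$ (both equal to $\mathbb{C}^d$ if $r=\infty$); $\langle\cdot,\cdot\rangle_d$ is the standard inner product on $\mathbb{C}^d$. A Hilbert function space (RKHS) on a set $X$ is a Hilbert space $\mathcal H$ of complex functions on $X$ all of whose point evaluations are bounded; $k_x\in\mathcal H$ is the vector with $f(x)=\langle f,k_x\rangle$ for all $f\in\mathcal H$. Generating function: a power series $G(t)=\sum_{n\ge0}a_nt^n$ with $a_0=1$, $a_n>0$ for all $n$, and radius of convergence in $(0,\infty]$. Weighted Hardy space in $d$ variables: a Hilbert function space of holomorphic functions on a ball $r\mathbb{B}_d$, $r\in(0,\infty]$, in which the monomials $z^\alpha$ form a complete orthogonal set of nonzero vectors with $\|z^\alpha\|^2/\alpha!=\|z^\beta\|^2/\beta!$ whenever $|\alpha|=|\beta|$, and $\|\mathbf{1}\|=1$. Equivalently its reproducing kernel is $K(z,w)=G(\langle z,w\rangle_d)$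 for a (unique) generating function $G=\sum a_nt^n$ (the generating function of the space), and then $\|z^\alpha\|^{-2}=a_{|\alpha|}\frac{|\alpha|!}{\alpha!}$. Convention: every weighted Hardy space is regarded as a space of functions on its natural maximal domain $X$: if $r^2\in(0,\infty]$ is the radius of convergence of $G$, then $X=\mathbb{C}^d$ if $r=\infty$; $X=r\mathbb{B}_d$ if $r<\infty$ and $G(r^2)=\infty$; $X=\overline{r\mathbb{B}_d}$ if $r<\infty$ and $G(r^2)<\infty$ (functions then extend continuously to the closed ball). An RKHS isomorphism from $\mathcal{H}_1$ (on $X_1$) to $\mathcal{H}_2$ (on $X_2$) is a bijective bounded linear map $T:\mathcal{H}_1\to\mathcal{H}_2$ with $T(k^1_x)=\overline{\lambda(x)}\,k^2_{\varphi(x)}$ for all $x\in X_1$, where $\lambda:X_1\to\mathbb{C}$ is nowhere vanishing and $\varphi:X_1\to X_2$ is a bijection; here $k^i_x$ denotes the reproducing kernel vector of $\mathcal{H}_i$ at $x$. *)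

(* Defs.v *)
From HB Require Import structures.
From mathcomp Require Import all_boot all_order all_algebra.
From mathcomp Require Import all_classical all_reals all_analysis.
From mathcomp Require Import complex.

Set Implicit Arguments.
Unset Strict Implicit.
Unset Printing Implicit Defensive.

Import Order.TTheory GRing.Theory Num.Theory.
Import numFieldNormedType.Exports.

Local Open Scope classical_set_scope.
Local Open Scope ring_scope.

(* [R[i]] carries the topology and norm that every [numFieldType] has as a
   normed module over itself. *)
#[warning="-redundant-canonical-projection"]
HB.instance Definition _ (R : rcfType) := NormedModule.copy R[i] R[i]^o.

(* A Hilbert function space on [X].  Its vectors are the points of [rk_space];
   [rk_eval] realizes them, injectively and linearly, as functions on [X]. The
   inner product [rk_dot] is linear in its first argument and
   conjugate-linear in the second one. *)
Record rkhs (R : realType) (X : Type) := RKHS {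
  rk_space :> completeNormedModType R[i] ;
  rk_dot : {dot rk_space for Num.conj} ;
  rk_dotE : forall f : rk_space, rk_dot f f = `|f| ^+ 2 ;
  rk_eval : {linear rk_space -> (X -> R[i])} ;
  rk_eval_inj : injective rk_eval ;
  rk_eval_bounded : forall x : X, exists M : R,
    forall f : rk_space, `|rk_eval f x| <= M%:C%C * `|f| }.

Arguments rk_dot {R X}.
Arguments rk_eval {R X}.

(* The vector representing evaluation at [x]; there is exactly one by the Riesz
   representation theorem, so the default value [0] is never used. *)
Definition rk_vec (R : realType) (X : Type) (H : rkhs R X) (x : X) : H :=
  xget 0 [set k : H | forall f : H, rk_eval H f x = rk_dot H f k].

Record is_rkhs_iso (R : realType) (X1 X2 : Type)
    (H1 : rkhs R X1) (H2 : rkhs R X2) (T : {linear H1 -> H2}) : Prop := {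
  iso_bijective : bijective T ;
  iso_bounded : exists M : R, forall f : H1, `|T f| <= M%:C%C * `|f| ;
  iso_kernel : exists (lambda : X1 -> R[i]) (phi : X1 -> X2),
    [/\ forall x, lambda x != 0,
        bijective phi &
        forall x, T (rk_vec H1 x) = (lambda x)^* *: rk_vec H2 (phi x)] }.

Definition rkhs_isomorphic (R : realType) (X1 X2 : Type)
    (H1 : rkhs R X1) (H2 : rkhs R X2) : Prop :=
  exists T : {linear H1 -> H2}, is_rkhs_iso T.

Definition cdot (R : realType) (d : nat) (z w : 'rV[R[i]]_d) : R[i] :=
  \sum_(j < d) z ord0 j * (w ord0 j)^*.

(* The library norm on ['rV_d] is the sup norm; this is the Euclidean one. *)
Definition enorm (R : realType) (d : nat) (z : 'rV[R[i]]_d) : R :=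
  Num.sqrt (\sum_(j < d) (complex.Re (z ord0 j) ^+ 2
                          + complex.Im (z ord0 j) ^+ 2)).

Definition conv_radius (R : realType) (a : R^nat) : \bar R :=
  ereal_sup [set t%:E | t in [set t : R | 0 <= t /\ cvgn (pseries a t)]].

Definition generating (R : realType) (a : R^nat) : Prop :=
  [/\ a 0%N = 1, forall n, 0 < a n & (0 < conv_radius a)%E].

(* The ball of radius [r], where [r^2 = conv_radius a]. *)
Definition hardy_ball (R : realType) (d : nat) (a : R^nat) :
    set 'rV[R[i]]_d :=
  match conv_radius a with
  | EFin rho => [set z | enorm z < Num.sqrt rho]
  | EPInf => setT
  | ENInf => set0
  end.

Definition hardy_domain (R : realType) (d : nat) (a : R^nat) :
    set 'rV[R[i]]_d :=
  match conv_radius a with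
  | EFin rho => if `[< cvgn (pseries a rho) >]
              then [set z | enorm z <= Num.sqrt rho]
              else [set z | enorm z < Num.sqrt rho]
  | EPInf => setT
  | ENInf => set0
  end.

Arguments hardy_ball {R} d a.
Arguments hardy_domain {R} d a.

Section MultiIndex.
Variable d : nat.
Implicit Type alpha : {ffun 'I_d -> nat}.

Definition mdegree alpha : nat := (\sum_(j < d) alpha j)%N.

Definition mfact alpha : nat := (\prod_(j < d) (alpha j)`!)%N.

Definition monomial (R : realType) alpha (z : 'rV[R[i]]_d) : R[i] :=
  \prod_(j < d) z ord0 j ^+ alpha j.

End MultiIndex.

(* [H] is a weighted Hardy space in [d] variables with generating function
   [\sum_n a n * t ^ n], as a space of functions on its maximal domain.
   The vector [mono alpha] is the monomial [z ^ alpha]. *)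
Record weighted_hardy (R : realType) (d : nat) (a : R^nat)
    (H : rkhs R (hardy_domain d a)) : Prop := {
  wh_generating : generating a ;
  wh_holomorphic : forall f : H, exists g : 'rV[R[i]]_d -> R[i],
    [/\ forall z, hardy_ball d a z -> differentiable g z,
        {within hardy_domain d a, continuous g} &
        forall x, rk_eval H f x = g (val x)] ;
  wh_monomials : exists mono : {ffun 'I_d -> nat} -> H,
    [/\ forall alpha x, rk_eval H (mono alpha) x = monomial alpha (val x),
        forall alpha, mono alpha != 0,
        forall alpha beta, alpha != beta ->
          rk_dot H (mono alpha) (mono beta) = 0,
        forall f : H, (forall alpha, rk_dot H f (mono alpha) = 0) -> f = 0 &
        (forall alpha beta, mdegree alpha = mdegree beta ->
          `|mono alpha| ^+ 2 / (mfact alpha)%:R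
          = `|mono beta| ^+ 2 / (mfact beta)%:R)
        /\ `|mono [ffun=> 0%N]| = 1] ;
  wh_kernel : forall z w : hardy_domain d a,
    series (fun n => (a n)%:C%C * cdot (val z) (val w) ^+ n) @ \oo
      --> rk_eval H (rk_vec H w) z }.

(* Main.v *)
Require Import Defs.
From HB Require Import structures.
From mathcomp Require Import all_boot all_order all_algebra.
From mathcomp Require Import all_classical all_reals all_analysis.
From mathcomp Require Import complex.
From mathcomp Require Import ring lra.
Import Order.TTheory GRing.Theory Num.Theory.
Import numFieldNormedType.Exports.

(** The isomorphism sends kernel vectors to kernel vectors without rescaling,
    [T k1_z = k2_(sqrt gamma z)]: here [lambda = 1] and [phi] is the dilation by
    [sqrt gamma].

    Since [b_n gamma^n] lies between [c a_n] and [C a_n], the two power series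
    [sum a_n t^n] and [sum b_n (gamma t)^n] converge for the same [t >= 0].
    The maximal domain of a weighted Hardy space is exactly the set of [z] at
    which the generating function converges at [|z|^2] ([hardy_domainP]), be it
    an open ball, a closed ball or the whole space, so the dilation is a
    bijection between the two domains.

    The squared norm of a finite combination of kernel vectors
    [sum_i c_i k1_(z_i)] is [sum_n a_n P_n], where [P_n] is the value at [c] of
    the Hermitian form with matrix [<z_j, z_i>^n].  That form is positive
    semidefinite ([gram_power_ge0]).  For the dilated kernel vectors of the
    second space the same [P_n] occur, with the weights [b_n gamma^n] in place
    of [a_n].  Comparing the two series term by term, the norms of
    corresponding combinations in the two spaces are equivalent
    ([lincomb_norm_le]).

    Combinations of kernel vectors are dense, because a function orthogonal to
    all kernel vectors vanishes everywhere ([lincomb_dense]).  Hence the map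
    defined on combinations extends to a bounded bijection
    ([bounded_iso_of_dense]).  Density and the existence of the kernel vectors
    (the Riesz representation theorem) both come from orthogonal projection
    ([orthogonal_projection]). *)

Set Implicit Arguments.
Unset Strict Implicit.
Unset Printing Implicit Defensive.
Local Open Scope classical_set_scope.
Local Open Scope ring_scope.

(** * Norms with real values *)

(** The norm of a normed space over [R[i]] takes its values in [R[i]]; its real
    part carries the same information in a complete ordered field, where infima
    exist and linear arithmetic applies. *)
Definition rnorm (R : realType) (V : normedModType R[i]) (f : V) : R :=
  complex.Re `|f|.

Section RealNorm.
Variables (R : realType) (V : normedModType R[i]).
Implicit Types f g : V.

Lemma rnormE f : `|f| = (rnorm f)%:C%C.
Proof. by rewrite /rnorm RRe_real// normr_real. Qed.

Lemma rnorm_ge0 f : 0 <= rnorm f.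
Proof. by rewrite -ler0c -rnormE normr_ge0. Qed.

Lemma rnorm_eq0 f : rnorm f = 0 -> f = 0.
Proof. by move=> f0; apply/eqP; rewrite -normr_eq0 rnormE f0. Qed.

Lemma rnormD f g : rnorm (f + g) <= rnorm f + rnorm g.
Proof. rewrite -lecR rmorphD /= -!rnormE; exact: ler_normD. Qed.

Lemma rnormN f : rnorm (- f) = rnorm f.
Proof. by rewrite /rnorm normrN. Qed.

Lemma rnormB f g : rnorm (f - g) = rnorm (g - f).
Proof. by rewrite -rnormN opprB. Qed.

Lemma rnormZ (a : R[i]) f : rnorm (a *: f) = complex.Re `|a| * rnorm f.
Proof.
apply: complexI; rewrite -rnormE normrZ rnormE rmorphM /=.
by rewrite RRe_real// normr_real.
Qed.

Lemma rnorm_dist f g : `|rnorm f - rnorm g| <= rnorm (f - g).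
Proof.
have := rnormD (f - g) g; have := rnormD (g - f) f.
rewrite !subrK (rnormB g f) ler_distlC => *; apply/andP; split; lra.
Qed.

Lemma cvg_rnormP (w : nat -> V) l : w @ \oo --> l <->
  forall e : R, 0 < e -> \forall n \near \oo, rnorm (l - w n) < e.
Proof.
split=> [/cvgrPdist_lt wl e e0|wl].
  have := wl e%:C%C; rewrite ltcR => /(_ e0).
  by apply: filterS => n; rewrite rnormE ltcR.
apply/cvgrPdist_lt => e e0.
have er : (complex.Re e)%:C%C = e by rewrite RRe_real// gtr0_real.
move: (e0); rewrite -er ltcR => /wl.
by apply: filterS => n; rewrite rnormE ltcR.
Qed.

Lemma cvg_rnorm (w : nat -> V) l : w @ \oo --> l ->
  rnorm (w n) @[n --> \oo] --> rnorm l.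
Proof.
move=> /cvg_rnormP wl; apply/cvgrPdist_lt => e /wl.
by apply: filterS => n; apply: le_lt_trans; exact: rnorm_dist.
Qed.

End RealNorm.

Lemma near_invS_lt (R : realType) (e : R) : 0 < e ->
  \forall n \near \oo, (n.+1%:R^-1 : R) < e.
Proof. by move=> e0; have := near_infty_natSinv_lt (PosNum e0). Qed.

Lemma invS_gt0 (R : realType) n : 0 < (n.+1%:R^-1 : R).
Proof. by rewrite invr_gt0. Qed.

(** * Finite linear combinations *)

(** A combination is a list of coefficients and indices rather than a function
    of finite support: one list is then evaluated in two families at once, and
    addition is concatenation. *)
Definition lincomb (R : realType) (V : lmodType R[i]) (I : Type) (u : I -> V)
    (s : seq (R[i] * I)) : V :=
  \sum_(p <- s) p.1 *: u p.2.

Section Lincomb.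
Variables (R : realType) (V : lmodType R[i]) (I : Type).
Implicit Types (u : I -> V) (s : seq (R[i] * I)).

Definition scale_comb a s : seq (R[i] * I) := [seq (a * p.1, p.2) | p <- s].

Lemma lincombD u s1 s2 : lincomb u (s1 ++ s2) = lincomb u s1 + lincomb u s2.
Proof. exact: big_cat. Qed.

Lemma lincombZ u a s : lincomb u (scale_comb a s) = a *: lincomb u s.
Proof.
rewrite /lincomb big_map scaler_sumr.
by apply: eq_bigr => p _; rewrite scalerA.
Qed.

Lemma lincombB u s1 s2 :
  lincomb u (s1 ++ scale_comb (-1) s2) = lincomb u s1 - lincomb u s2.
Proof. by rewrite lincombD lincombZ scaleN1r. Qed.

Lemma lincomb1 u i : lincomb u [:: (1, i)] = u i.
Proof. by rewrite /lincomb big_seq1 scale1r. Qed.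

End Lincomb.

(** * Projection, density and the Riesz representation *)

Section Completeness.
Variables (R : realType) (V : completeNormedModType R[i]).

(** Completeness with an explicit rate, the form in which both minimizing
    sequences and sequences of approximants produce their limits. *)
Lemma cvg_of_invS_cauchy (w : nat -> V) (B : R) :
  (forall n k, rnorm (w n - w k) <= B * (n.+1%:R^-1 + k.+1%:R^-1)) ->
  exists l : V, w @ \oo --> l.
Proof.
move=> wB.
suff : cvg (w @ \oo) by move=> ?; exists (lim (w @ \oo)).
apply/cauchy_cvgP/cauchy_exP => e e0.
have er : (complex.Re e)%:C%C = e by rewrite RRe_real// gtr0_real.
move: (e0); rewrite -er ltcR; set r := complex.Re e => r0.
pose B' : R := 2 * (`|B| + 1).
have B'0 : 0 < B' by rewrite /B'; have := normr_ge0 B; lra.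
have [N _ HN] := near_invS_lt (divr_gt0 r0 B'0).
exists (w N); exists N => // n /= nN.
rewrite /= -ball_normE /ball_ /= rnormE ltcR.
apply: le_lt_trans (wB N n) _.
have /= := HN N (leqnn N); have /= := HN n nN.
rewrite !ltr_pdivlMr// => h1 h2.
have := invS_gt0 R n; have := invS_gt0 R N.
move: h1 h2; rewrite /B'.
set x := n.+1%:R^-1; set y := N.+1%:R^-1 => h1 h2 y0 x0.
have := ler_norm B; nra.
Qed.

End Completeness.

Section Hilbert.
Variables (R : realType) (V : completeNormedModType R[i]).
Variable dot : {dot V for Num.conj}.
Hypothesis dotE : forall f, dot f f = `|f| ^+ 2.
Implicit Types f g p q m : V.

Lemma dot_rnorm f : dot f f = (rnorm f)%:C%C ^+ 2.
Proof. by rewrite dotE rnormE. Qed.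

Lemma dotC f g : dot f g = (dot g f)^*.
Proof. by rewrite (hermC dot) expr0 mul1r. Qed.

Lemma dotZr a f g : dot f (a *: g) = a^* * dot f g.
Proof. by rewrite dotC linearZl_LR rmorphM /= -dotC. Qed.

Lemma dotZl a f g : dot (a *: f) g = a * dot f g.
Proof. exact: linearZl_LR. Qed.

Lemma dotBl f g h : dot (f - g) h = dot f h - dot g h.
Proof. exact: linearBl. Qed.

Lemma dot_suml (J : Type) (s : seq J) (F : J -> V) g :
  dot (\sum_(j <- s) F j) g = \sum_(j <- s) dot (F j) g.
Proof. exact: linear_sumlz. Qed.

Lemma dot_sumr (J : Type) (s : seq J) (F : J -> V) f :
  dot f (\sum_(j <- s) F j) = \sum_(j <- s) dot f (F j).
Proof. exact: linear_sumr. Qed.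

Lemma dotBB f g :
  dot (f - g) (f - g) = dot f f + dot g g - (dot f g + (dot f g)^*).
Proof. by have /= := hnormB dot f g; rewrite expr0 mul1r. Qed.

Lemma parallelogram f g :
  rnorm (f + g) ^+ 2 + rnorm (f - g) ^+ 2
    = 2 * rnorm f ^+ 2 + 2 * rnorm g ^+ 2.
Proof.
apply: complexI; rewrite !(rmorphXn, rmorphD, rmorphM, rmorph1) /=.
rewrite -!dot_rnorm.
by rewrite (hnormB dot) (hnormD dot); ring.
Qed.

(** Subtracting [t m] with [t = s <q, m>], [s > 0], changes the squared norm of
    [q] by [- 2 s |<q, m>|^2 + s^2 |<q, m>|^2 |m|^2].  For small [s] this is
    negative unless [<q, m> = 0]. *)
Lemma orthogonal_of_nearest q m :
  (forall t : R[i], rnorm q ^+ 2 <= rnorm (q - t *: m) ^+ 2) -> dot q m = 0.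
Proof.
move=> qmin; set d := dot q m.
have [A A0 AE] : exists2 A : R, 0 <= A & A%:C%C = `|d| ^+ 2.
  have AE : (complex.Re (`|d| ^+ 2))%:C%C = `|d| ^+ 2.
    by rewrite RRe_real// realX// normr_real.
  by exists (complex.Re (`|d| ^+ 2)) => //; rewrite -ler0c AE exprn_ge0.
have [s s0 sm] : exists2 s : R, 0 < s & s * rnorm m ^+ 2 <= 1.
  have m1 : 0 < rnorm m ^+ 2 + 1 by rewrite ltr_wpDl// sqr_ge0.
  exists (rnorm m ^+ 2 + 1)^-1; first by rewrite invr_gt0.
  by rewrite mulrC ler_pdivrMr// mul1r lerDl.
have E : rnorm (q - (s%:C%C * d) *: m) ^+ 2
       = rnorm q ^+ 2 + s ^+ 2 * A * rnorm m ^+ 2 - 2 * (s * A).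
  have sR : (s%:C%C)^* = s%:C%C by rewrite conj_Creal// complex_real.
  apply: complexI.
  rewrite !(rmorphXn, rmorphB, rmorphD, rmorphM, rmorph1) /=.
  rewrite -!dot_rnorm dotBB.
  rewrite dotZl !dotZr -/d !rmorphM /= ?sR ?conjCK AE normCK.
  by ring.
have := qmin (s%:C%C * d); rewrite E => h.
have A0' : A = 0.
  apply/eqP; rewrite eq_le A0 andbT.
  have : 2 * (s * A) <= s * A * (s * rnorm m ^+ 2) by nra.
  have : s * A * (s * rnorm m ^+ 2) <= s * A.
    by rewrite ler_piMr// mulr_ge0// ltW.
  have sA : 0 <= s * A by rewrite mulr_ge0// ltW.
  move=> h1 h2; have : s * A <= 0 by lra.
  by rewrite pmulr_rle0.
by apply/eqP; rewrite -normr_eq0 -sqrf_eq0 -AE A0'.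
Qed.

(** By the parallelogram law a minimizing sequence for the distance from [f] to
    [M] is Cauchy; its limit [p] is nearest to [f] in the closure of [M]. *)
Lemma orthogonal_projection (M : set V) f :
  M 0 -> (forall (a : R[i]) x y, M x -> M y -> M (a *: x + y)) ->
  exists p, (forall e : R, 0 < e -> exists2 m, M m & rnorm (p - m) < e) /\
            (forall m, M m -> dot (f - p) m = 0).
Proof.
move=> M0 Mlin.
pose E := [set rnorm (f - m) ^+ 2 | m in M].
have lbE : has_lbound E by exists 0 => _ [m _ <-]; exact: sqr_ge0.
have E0 : E !=set0 by exists (rnorm (f - 0) ^+ 2), 0.
pose D := inf E.
have DM m : M m -> D <= rnorm (f - m) ^+ 2.
  by move=> Mm; apply: ge_inf => //; exists m.
(* The excess over [D] is squared so that the parallelogram law yields a rate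
   linear in the inverses of [n + 1] and [k + 1]. *)
have /choice [w Hw] : forall n : nat, exists m, M m /\
    rnorm (f - m) ^+ 2 < D + n.+1%:R^-1 ^+ 2.
  move=> n.
  have [|_ [m Mm <-] ?] := @inf_adherent _ E (n.+1%:R^-1 ^+ 2) _ (conj E0 lbE).
    by rewrite exprn_gt0// invS_gt0.
  by exists m.
have [|p wp] := @cvg_of_invS_cauchy _ _ w 2.
  move=> n k.
  have Mid : M (2^-1 *: (w n + w k)).
    rewrite -[_ *: _]addr0; apply: (Mlin) => //.
    by rewrite -[w n]scale1r; apply: (Mlin); [exact: (Hw n).1|exact: (Hw k).1].
  have := parallelogram (f - w n) (f - w k).
  have -> : f - w n - (f - w k) = w k - w n.
    by rewrite opprB addrCA addrAC subrr add0r.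
  have -> : f - w n + (f - w k) = 2 *: (f - 2^-1 *: (w n + w k)).
    rewrite scalerBr scalerA divff ?scale1r; last by rewrite pnatr_eq0.
    by rewrite scaler_nat mulr2n opprD addrACA.
  rewrite rnormZ exprMn normr_nat.
  have -> : complex.Re (2%:R : R[i]) = 2.
    by have -> : (2%:R : R[i]) = (2 : R)%:C%C by rewrite rmorphMn rmorph1.
  have := DM _ Mid; have [_ hn] := Hw n; have [_ hk] := Hw k.
  rewrite (rnormB (w n)) => h1 h2.
  have x0 := invS_gt0 R n; have y0 := invS_gt0 R k.
  move: (n.+1%:R^-1) (k.+1%:R^-1) hn hk x0 y0 => x y hn hk x0 y0.
  rewrite -ler_sqr ?nnegrE ?rnorm_ge0//; first nra.
  by rewrite mulr_ge0// addr_ge0// ltW.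
have lim m :
    (fun n => rnorm (f - w n - m) ^+ 2) @ \oo --> rnorm (f - p - m) ^+ 2.
  apply: cvgM; apply: cvg_rnorm; apply: cvgB; try exact: cvg_cst.
    by apply: cvgB => //; exact: cvg_cst.
  by apply: cvgB => //; exact: cvg_cst.
exists p; split=> [e e0|m Mm].
  move/cvg_rnormP: wp => /(_ e e0) [N _ /(_ N (leqnn N)) /= h].
  by exists (w N) => //; exact: (Hw N).1.
apply: orthogonal_of_nearest => t.
apply: (@le_trans _ _ D).
  have := lim 0; rewrite subr0 => h.
  have hD : (fun n => D + n.+1%:R^-1 ^+ 2) @ \oo --> D.
    rewrite -[X in _ --> X]addr0 -[X in _ --> _ + X](mul0r 0).
    apply: cvgD; first exact: cvg_cst.
    by apply: cvgM; exact: cvg_harmonic.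
  apply: ler_cvg_to h hD _; near=> n; rewrite subr0.
  exact/ltW/(Hw n).2.
apply: (ler_cvg_to (cvg_cst D) (lim (t *: m))).
near=> n; rewrite -addrA -opprD [w n + _]addrC; apply: DM.
by apply: (Mlin); last exact: (Hw n).1.
Unshelve. all: by end_near. Qed.

(** The residual of projecting [f] on the span is orthogonal to every [u i]. *)
Lemma lincomb_dense I (u : I -> V) :
  (forall f, (forall i, dot f (u i) = 0) -> f = 0) ->
  forall f (e : R), 0 < e -> exists s, rnorm (f - lincomb u s) < e.
Proof.
move=> utotal f e e0.
have [||p [pM fp]] := @orthogonal_projection (range (lincomb u)) f.
- by exists [::] => //; rewrite /lincomb big_nil.
- move=> a _ _ [s1 _ <-] [s2 _ <-]; exists (scale_comb a s1 ++ s2) => //.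
  by rewrite lincombD lincombZ.
have [_ [s _ <-] ps] := pM e e0; exists s.
suff -> : f = p by [].
apply/eqP; rewrite -subr_eq0; apply/eqP/utotal => i.
by apply: fp; exists [:: (1, i)] => //; rewrite lincomb1.
Qed.

(** A vector [q] orthogonal to the kernel of [phi], obtained by projecting any
    [f0] with [phi f0 != 0] on that kernel, represents [phi] up to a scalar. *)
Lemma riesz_representation (phi : {linear V -> R[i]^o}) (M : R) :
  (forall f, `|phi f| <= M%:C%C * `|f|) ->
  exists k, forall f, phi f = dot f k.
Proof.
move=> phiM.
have [[f0 f00]|phi0] := pselect (exists f0, phi f0 != 0); last first.
  exists 0 => f; rewrite linear0r; apply: contrapT => /eqP fn0.
  by apply: phi0; exists f.
have [||p [pM fp]] := @orthogonal_projection [set f | phi f = 0] f0.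
- exact: raddf0.
- by move=> a x y /= x0 y0; rewrite linearP x0 y0 addr0 scaler0.
(* Boundedness enters here: the kernel of [phi] is closed. *)
have p0 : phi p = 0.
  apply: contrapT => /eqP pn0.
  have p_gt0 : 0 < rnorm (phi p : R[i]^o) by rewrite -ltcR -rnormE normr_gt0.
  have M0 : 0 < `|M| + 1 by have := normr_ge0 M; lra.
  have [m /= m0 pm] := pM _ (divr_gt0 p_gt0 M0).
  have := phiM (p - m); rewrite raddfB /= m0 subr0 !rnormE -rmorphM lecR => h.
  move: pm; rewrite ltr_pdivlMr//.
  have := ler_norm M; have := rnorm_ge0 (p - m); nra.
pose q := f0 - p.
have q0 : phi q != 0 by rewrite raddfB /= p0 subr0.
have dq0 : dot q q != 0.
  rewrite dotE expf_neq0// normr_eq0.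
  by apply: contraNneq q0 => ->; rewrite raddf0.
exists (((phi q)^* / dot q q) *: q) => f.
rewrite dotZr rmorphM /= conjCK fmorphV /= -dotC.
have : dot q (f - (phi f / phi q) *: q) = 0.
  apply: fp => /=; rewrite raddfB /= linearZ_LR /= /GRing.scale /=.
  by rewrite mulfVK// subrr.
move=> h; have := congr1 Num.conj h; rewrite -dotC rmorph0.
rewrite dotBl dotZl => /eqP; rewrite subr_eq0 => /eqP ->.
by rewrite mulrACA mulVf// mulr1 mulrCA divff// mulr1.
Qed.

End Hilbert.

(** * Extension of a map between dense spans *)

Section PairClosure.
Variables (R : realType) (V1 V2 : completeNormedModType R[i]) (I : Type).
Variables (u : I -> V1) (v : I -> V2).

(** The closure in [V1 * V2] of the graph [lincomb u s |-> lincomb v s]. Working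
    with the closed graph avoids having to show that the map on combinations is
    well defined before extending it, and it is symmetric in the two families,
    so that injectivity and surjectivity follow by exchanging them. *)
Definition limit_pair (f : V1) (g : V2) : Prop := forall e : R, 0 < e ->
  exists s, rnorm (f - lincomb u s) < e /\ rnorm (g - lincomb v s) < e.

Lemma limit_pair_lincomb s : limit_pair (lincomb u s) (lincomb v s).
Proof.
by move=> e e0; exists s; rewrite !subrr /rnorm !normr0.
Qed.

Lemma limit_pair_linear (a : R[i]) f f' g g' :
  limit_pair f g -> limit_pair f' g' ->
  limit_pair (a *: f + f') (a *: g + g').
Proof.
move=> fg fg' e e0; set k := complex.Re `|a|.
have k0 : 0 <= k by rewrite -ler0c RRe_real// normr_real.
have k1 : 0 < k + 1 by lra.
have e2 : 0 < e / 2 by lra.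
have [s [s1 s2]] := fg _ (divr_gt0 e2 k1).
have [s' [s1' s2']] := fg' _ e2.
exists (scale_comb a s ++ s').
have bound (V : normedModType R[i]) (x x' y y' : V) :
    rnorm (x - y) < e / 2 / (k + 1) -> rnorm (x' - y') < e / 2 ->
    rnorm (a *: x + x' - (a *: y + y')) < e.
  move=> xy xy'; rewrite opprD addrACA -scalerBr.
  apply: le_lt_trans (rnormD _ _) _; rewrite rnormZ -/k.
  move: xy; rewrite ltr_pdivlMr// => xy.
  have := rnorm_ge0 (x - y); nra.
by rewrite !lincombD !lincombZ; split; apply: bound.
Qed.

Variable K : R.
Hypothesis vK : forall s, rnorm (lincomb v s) <= K * rnorm (lincomb u s).

Lemma limit_pair_le f g : limit_pair f g -> rnorm g <= `|K| * rnorm f.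
Proof.
move=> fg; apply/ler_addgt0Pr => e e0.
have k0 := normr_ge0 K.
have k1 : 0 < `|K| + 1 by lra.
have [s [s1 s2]] := fg _ (divr_gt0 e0 k1).
have ed : e = `|K| * (e / (`|K| + 1)) + e / (`|K| + 1).
  by rewrite -[X in _ + X]mul1r -mulrDl mulrC divfK// gt_eqF.
have h1 := rnormD (g - lincomb v s) (lincomb v s).
have h2 := rnormD (lincomb u s - f) f.
rewrite !subrK (rnormB _ f) in h1 h2.
have : K * rnorm (lincomb u s) <= `|K| * rnorm (lincomb u s).
  by rewrite ler_wpM2r ?rnorm_ge0 ?ler_norm.
have : `|K| * rnorm (lincomb u s) <= `|K| * (e / (`|K| + 1) + rnorm f).
  apply: ler_wpM2l => //; lra.
have := vK s; rewrite mulrDr; lra.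
Qed.

Lemma limit_pair_uniq f g g' : limit_pair f g -> limit_pair f g' -> g = g'.
Proof.
move=> fg fg'; apply/eqP; rewrite eq_sym -subr_eq0; apply/eqP/rnorm_eq0.
have := limit_pair_le (limit_pair_linear (-1) fg fg').
rewrite !scaleN1r addNr addrC [rnorm 0]/rnorm normr0 mulr0 => h.
by apply/eqP; rewrite eq_le h rnorm_ge0.
Qed.

Hypothesis u_dense :
  forall f (e : R), 0 < e -> exists s, rnorm (f - lincomb u s) < e.

(** Combinations of [u] approaching [f] are Cauchy, hence so are, by [vK], the
    corresponding combinations of [v]. *)
Lemma limit_pair_total f : exists g, limit_pair f g.
Proof.
have /choice [s Hs] : forall n : nat,
    exists s, rnorm (f - lincomb u s) < n.+1%:R^-1.
  by move=> n; apply: u_dense; exact: invS_gt0.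
have [|g wg] := @cvg_of_invS_cauchy _ _ (fun n => lincomb v (s n)) `|K|.
  move=> n k; rewrite -lincombB; apply: le_trans (vK _) _; rewrite lincombB.
  have := rnormD (lincomb u (s n) - f) (f - lincomb u (s k)).
  rewrite subrKA (rnormB _ f) => h.
  have : K * rnorm (lincomb u (s n) - lincomb u (s k))
      <= `|K| * rnorm (lincomb u (s n) - lincomb u (s k)).
    by rewrite ler_wpM2r ?rnorm_ge0 ?ler_norm.
  move=> /le_trans; apply; apply: ler_wpM2l => //.
  by apply: le_trans h _; apply: lerD; exact/ltW/Hs.
exists g => e e0; move/cvg_rnormP: wg => /(_ e e0) wg.
have [N _ HN] := filterI wg (near_invS_lt e0).
have [h1 h2] := HN N (leqnn N).
by exists (s N); split=> //; apply: lt_trans (Hs N) _.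
Qed.

End PairClosure.

Lemma limit_pair_sym (R : realType) (V1 V2 : completeNormedModType R[i]) I
    (u : I -> V1) (v : I -> V2) f g :
  limit_pair u v f g -> limit_pair v u g f.
Proof. by move=> fg e /fg[s [? ?]]; exists s. Qed.

(** The closed graph is total and single-valued in both directions: totality
    comes from density, single-valuedness from the norm bound. *)
Lemma bounded_iso_of_dense (R : realType) (V1 V2 : completeNormedModType R[i])
    (I : Type) (u : I -> V1) (v : I -> V2) (K K' : R) :
  (forall f (e : R), 0 < e -> exists s, rnorm (f - lincomb u s) < e) ->
  (forall g (e : R), 0 < e -> exists s, rnorm (g - lincomb v s) < e) ->
  (forall s, rnorm (lincomb v s) <= K * rnorm (lincomb u s)) ->
  (forall s, rnorm (lincomb u s) <= K' * rnorm (lincomb v s)) ->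
  exists T : {linear V1 -> V2},
    [/\ bijective T, forall f, rnorm (T f) <= `|K| * rnorm f &
        forall i, T (u i) = v i].
Proof.
move=> du dv vK uK.
have [T0 HT] := choice (limit_pair_total vK du).
have [S0 HS] := choice (limit_pair_total uK dv).
have Tlin : linear T0.
  move=> a f g; apply: (limit_pair_uniq vK (HT _)).
  exact: limit_pair_linear (HT f) (HT g).
pose T : {linear V1 -> V2} := HB.pack T0 (GRing.isLinear.Build _ _ _ _ T0 Tlin).
exists T; split.
- exists S0 => [f|g] /=.
    exact: (limit_pair_uniq uK (HS _) (limit_pair_sym (HT f))).
  exact: (limit_pair_uniq vK (HT _) (limit_pair_sym (HS g))).
- move=> f; have := limit_pair_le vK (HT f); exact.
- move=> i; apply: (limit_pair_uniq vK (HT _)).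
  rewrite -(lincomb1 u i) -(lincomb1 v i).
  exact: limit_pair_lincomb.
Qed.

(** * Gram forms of power kernels *)

Section Gram.
Variables (R : realType) (d : nat) (I : Type) (x : I -> 'rV[R[i]]_d).

Definition gram_power (n : nat) (s : seq (R[i] * I)) : R[i] :=
  \sum_(p <- s) \sum_(q <- s) p.1 * q.1^* * cdot (x q.2) (x p.2) ^+ n.

(** Expanding over words [J] of length [n] instead of multi-indices removes the
    multinomial coefficients and displays [<z, w>^n] as an inner product of
    vectors indexed by words. *)
Lemma cdotXn n (z w : 'rV[R[i]]_d) : cdot z w ^+ n =
  \sum_(J : {ffun 'I_n -> 'I_d})
    (\prod_k z ord0 (J k)) * (\prod_k w ord0 (J k))^*.
Proof.
rewrite -[n in LHS]card_ord -prodr_const /cdot.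
rewrite (bigA_distr_bigA (fun _ j => z ord0 j * (w ord0 j)^*)) /=.
by apply: eq_bigr => J _; rewrite big_split /= rmorph_prod.
Qed.

(** By [cdotXn] the form is a sum over words of squared moduli. *)
Lemma gram_power_ge0 n s : 0 <= gram_power n s.
Proof.
pose m J p : R[i] := p.1 * (\prod_(k < n) x p.2 ord0 (J k))^*.
have -> : gram_power n s =
    \sum_(J : {ffun 'I_n -> 'I_d}) `|\sum_(p <- s) m J p| ^+ 2.
  under [RHS]eq_bigr do rewrite normCK rmorph_sum mulr_suml.
  rewrite exchange_big; apply: eq_bigr => p _ /=.
  under [RHS]eq_bigr do rewrite mulr_sumr.
  rewrite exchange_big; apply: eq_bigr => q _ /=.
  rewrite cdotXn mulr_sumr; apply: eq_bigr => J _.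
  by rewrite /m rmorphM /= conjCK; ring.
by apply: sumr_ge0 => J _; rewrite exprn_ge0.
Qed.

End Gram.

Section GramSeries.
Variables (R : realType) (d : nat) (I : Type) (x : I -> 'rV[R[i]]_d).

(** The indices carry points [x i], which allows the points of one space to
    label the kernel vectors of another; the arguments of [cdot] are swapped
    because [k_w] evaluated at [z] is [<k_w, k_z>]. *)
Definition power_kernel (V : completeNormedModType R[i])
    (dot : {dot V for Num.conj}) (u : I -> V) (a : nat -> R) : Prop :=
  forall i j, series (fun n => (a n)%:C%C * cdot (x j) (x i) ^+ n) @ \oo
    --> dot (u i) (u j).

Lemma cvg_sum_seq (J : Type) (s : seq J) (f : J -> nat -> R[i])
    (l : J -> R[i]) :
  (forall j, f j @ \oo --> l j) ->
  \sum_(j <- s) f j n @[n --> \oo] --> \sum_(j <- s) l j.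
Proof.
move=> fl; apply: cvg_big => //; exact: add_continuous.
Qed.

(** Nonnegativity in [R[i]] is the closed condition [`|l| = l]. *)
Lemma ge0_cvg (f : nat -> R[i]) (l : R[i]) :
  f @ \oo --> l -> (forall n, 0 <= f n) -> 0 <= l.
Proof.
move=> fl f0; apply/normr_idP.
have fE : (fun n => `|f n|) = f by apply/funext => n; rewrite ger0_norm.
have fn : (fun n => `|f n|) @ \oo --> `|l| by exact: cvg_norm.
rewrite fE in fn; exact: (cvg_unique (@norm_hausdorff _ R[i]) fn fl).
Qed.

Lemma cvg_lincomb_norm (V : completeNormedModType R[i])
    (dot : {dot V for Num.conj}) (u : I -> V) (a : nat -> R) s :
  (forall f, dot f f = `|f| ^+ 2) -> power_kernel dot u a ->
  series (fun n => (a n)%:C%C * gram_power x n s) @ \oo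
    --> `|lincomb u s| ^+ 2.
Proof.
move=> dotE ua; rewrite -dotE.
have -> : dot (lincomb u s) (lincomb u s) =
    \sum_(p <- s) \sum_(q <- s) p.1 * q.1^* * dot (u p.2) (u q.2).
  rewrite {1}/lincomb dot_suml; apply: eq_bigr => p _.
  rewrite /lincomb dot_sumr; apply: eq_bigr => q _.
  by rewrite dotZl dotZr mulrA.
have -> : series (fun n => (a n)%:C%C * gram_power x n s) =
    fun n => \sum_(p <- s) \sum_(q <- s) p.1 * q.1^* *
      series (fun n => (a n)%:C%C * cdot (x q.2) (x p.2) ^+ n) n.
  apply/funext => n; rewrite !seriesEnat /= /gram_power.
  under eq_bigr do rewrite mulr_sumr.
  rewrite exchange_big; apply: eq_bigr => p _ /=.
  under eq_bigr do rewrite mulr_sumr.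
  rewrite exchange_big; apply: eq_bigr => q _ /=.
  by rewrite mulr_sumr; apply: eq_bigr => k _; rewrite mulrCA.
apply: cvg_sum_seq => p; apply: cvg_sum_seq => q.
by apply: cvgM; [exact: cvg_cst|exact: ua].
Qed.

(** The difference [K |sum c_i u_i|^2 - |sum c_i v_i|^2] is the sum of a series
    with nonnegative terms [(K a_n - b_n) gram_power x n s]. *)
Lemma lincomb_norm_le (V1 V2 : completeNormedModType R[i])
    (dot1 : {dot V1 for Num.conj}) (dot2 : {dot V2 for Num.conj})
    (u : I -> V1) (v : I -> V2) (a b : nat -> R) (K : R) s :
  (forall f, dot1 f f = `|f| ^+ 2) -> (forall f, dot2 f f = `|f| ^+ 2) ->
  power_kernel dot1 u a -> power_kernel dot2 v b ->
  0 <= K -> (forall n, b n <= K * a n) ->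
  rnorm (lincomb v s) <= Num.sqrt K * rnorm (lincomb u s).
Proof.
move=> dE1 dE2 ua vb K0 bK.
have : 0 <= K%:C%C * `|lincomb u s| ^+ 2 - `|lincomb v s| ^+ 2.
  apply: (@ge0_cvg (fun n =>
      K%:C%C * series (fun n => (a n)%:C%C * gram_power x n s) n
      - series (fun n => (b n)%:C%C * gram_power x n s) n)).
    apply: cvgB; last exact: cvg_lincomb_norm.
    by apply: cvgM; [exact: cvg_cst|exact: cvg_lincomb_norm].
  move=> n; rewrite !seriesEnat /= mulr_sumr -sumrB; apply: sumr_ge0 => k _.
  rewrite mulrA -mulrBl; apply: mulr_ge0; last exact: gram_power_ge0.
  by rewrite -rmorphM subr_ge0 lecR.
rewrite !rnormE subr_ge0 -!rmorphXn -rmorphM lecR => h.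
rewrite -[leLHS]ger0_norm ?rnorm_ge0// -sqrtr_sqr.
rewrite -[X in _ * X]ger0_norm ?rnorm_ge0// -sqrtr_sqr.
by rewrite -sqrtrM//; exact: ler_wsqrtr.
Qed.
End GramSeries.

(** * Maximal domains and dilations *)

Section Domain.
Variables (R : realType) (d : nat).

(** The open ball, closed ball and whole space cases of the maximal domain have
    this common description, through which domains are compared by comparing
    series. *)
Lemma hardy_domainP (a : nat -> R) (z : 'rV[R[i]]_d) :
  (0 < conv_radius a)%E ->
  hardy_domain d a z <-> cvgn (pseries a (enorm z ^+ 2)).
Proof.
rewrite /hardy_domain => r0.
have z0 : 0 <= enorm z by exact: sqrtr_ge0.
have t0 : 0 <= enorm z ^+ 2 by exact: sqr_ge0.
have inside t : 0 <= t -> (t%:E < conv_radius a)%E -> cvgn (pseries a t).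
  move=> t0' /ereal_sup_gt[_ [t' [t'0 t'cvg] <-]]; rewrite lte_fin => tt'.
  by apply: is_cvg_pseries_inside t'cvg _; rewrite !ger0_norm.
have below t : 0 <= t -> cvgn (pseries a t) -> (t%:E <= conv_radius a)%E.
  by move=> t0' tcvg; apply: ereal_sup_ubound; exists t.
case: (conv_radius a) r0 inside below => [rho||] //= r0 inside below;
  last first.
  by split=> // _; apply: inside; rewrite ?ltry.
rewrite lte_fin in r0.
have sqr_le : (enorm z <= Num.sqrt rho) = (enorm z ^+ 2 <= rho).
  by rewrite -[in RHS](sqr_sqrtr (ltW r0)) ler_sqr ?nnegrE ?sqrtr_ge0.
have sqr_lt : (enorm z < Num.sqrt rho) = (enorm z ^+ 2 < rho).
  by rewrite -[in RHS](sqr_sqrtr (ltW r0)) ltr_sqr ?nnegrE ?sqrtr_ge0.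
case: asboolP => rcvg /=; rewrite ?sqr_le ?sqr_lt.
  split=> [|tcvg]; last by rewrite -lee_fin; exact: below.
  rewrite le_eqVlt => /predU1P[->//|h].
  by apply: inside; rewrite ?lte_fin.
split=> [h|tcvg]; first by apply: inside; rewrite ?lte_fin.
rewrite lt_neqAle -lee_fin below// andbT.
by apply: contra_not_neq rcvg => <-.
Qed.

Lemma enormZ (k : R) (z : 'rV[R[i]]_d) : 0 <= k ->
  enorm (k%:C%C *: z) = k * enorm z.
Proof.
move=> k0; rewrite /enorm.
have -> : k = Num.sqrt (k ^+ 2) by rewrite sqrtr_sqr ger0_norm.
rewrite -sqrtrM ?sqr_ge0// sqrtr_sqr ger0_norm// mulr_sumr.
congr Num.sqrt; apply: eq_bigr => j _; rewrite mxE.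
by case: (z ord0 j) => x y /=; ring.
Qed.

Lemma cdotZ (k : R) (z w : 'rV[R[i]]_d) :
  cdot (k%:C%C *: z) (k%:C%C *: w) = (k ^+ 2)%:C%C * cdot z w.
Proof.
have kR : (k%:C%C)^* = k%:C%C by rewrite conj_Creal// complex_real.
rewrite /cdot mulr_sumr; apply: eq_bigr => j _.
by rewrite !mxE rmorphM rmorphXn /= kR; ring.
Qed.

Lemma hardy_domain_dilation (a b : nat -> R) (gamma K : R) (z : 'rV[R[i]]_d) :
  generating a -> generating b -> 0 < gamma ->
  (forall n, b n * gamma ^+ n <= K * a n) ->
  hardy_domain d a z -> hardy_domain d b ((Num.sqrt gamma)%:C%C *: z).
Proof.
move=> [_ a0 ra] [_ b0 rb] g0 baK /(hardy_domainP _ ra) acvg.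
apply/(hardy_domainP _ rb); rewrite enormZ ?sqrtr_ge0//.
rewrite exprMn sqr_sqrtr ?(ltW g0)//.
have K0 : 0 <= K.
  have := baK 0%N; rewrite expr0 mulr1 => h.
  by have := lt_le_trans (b0 0%N) h; rewrite pmulr_lgt0// => /ltW.
set t := enorm z ^+ 2 in acvg *.
have t0 : 0 <= t by exact: sqr_ge0.
apply: (series_le_cvg _ _ _ (is_cvg_seriesZ (k := K) acvg)) => n.
- by rewrite /= mulr_ge0 ?(ltW (b0 _))// exprn_ge0// mulr_ge0// ltW.
- rewrite /=; apply: mulr_ge0 => //; apply: mulr_ge0; first exact/ltW.
  exact: exprn_ge0.
- rewrite /= exprMn mulrA [leRHS]mulrA; apply: ler_wpM2r => //.
  exact: exprn_ge0.
Qed.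

End Domain.

(** * Kernel vectors and the isomorphism *)

Section Reproducing.
Variables (R : realType) (X : Type) (H : rkhs R X).

Lemma rk_vecE (x : X) (f : H) : rk_eval H f x = rk_dot H f (rk_vec H x).
Proof.
have [M xM] := rk_eval_bounded H x.
pose ev (f : H) : R[i]^o := rk_eval H f x.
have evlin : linear ev by move=> a g h; rewrite /ev linearP.
pose L : {linear H -> R[i]^o} :=
  HB.pack ev (GRing.isLinear.Build _ _ _ _ ev evlin).
have [k Hk] := @riesz_representation _ _ (rk_dot H) (@rk_dotE _ _ H) L M xM.
have kP : [set k : H | forall f : H, rk_eval H f x = rk_dot H f k] k.
  by move=> g; exact: Hk.
exact: (xgetPex 0 (ex_intro _ k kP)).
Qed.

Lemma rk_vec_total (f : H) : (forall x, rk_dot H f (rk_vec H x) = 0) -> f = 0.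
Proof.
move=> f0; apply: (@rk_eval_inj _ _ H); rewrite linear0; apply/funext => x.
by rewrite rk_vecE f0.
Qed.

End Reproducing.

(** Only the kernels matter: the points of [X1] label kernel vectors of both
    spaces, those of [H2] through [phi], and comparable coefficients make the
    two labelled families equivalent. *)
Lemma rkhs_isomorphic_of_kernel (R : realType) (d : nat) (X1 X2 : Type)
    (H1 : rkhs R X1) (H2 : rkhs R X2) (x : X1 -> 'rV[R[i]]_d) (phi : X1 -> X2)
    (a b : nat -> R) (K K' : R) :
  bijective phi ->
  power_kernel x (rk_dot H1) (rk_vec H1) a ->
  power_kernel x (rk_dot H2) (rk_vec H2 \o phi) b ->
  0 <= K -> 0 <= K' ->
  (forall n, b n <= K * a n) -> (forall n, a n <= K' * b n) ->
  rkhs_isomorphic H1 H2.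
Proof.
move=> phi_bij ker1 ker2 K0 K'0 baK abK'.
have [||||T [Tbij TK Tk]] := @bounded_iso_of_dense _ H1 H2 X1 (rk_vec H1)
    (rk_vec H2 \o phi) (Num.sqrt K) (Num.sqrt K').
- by apply: (lincomb_dense (@rk_dotE _ _ H1)); exact: rk_vec_total.
- apply: (lincomb_dense (@rk_dotE _ _ H2)) => f f0.
  apply: rk_vec_total => y; have [psi _ psiK] := phi_bij.
  by rewrite -(psiK y); exact: f0.
- move=> s.
  exact: (lincomb_norm_le s (@rk_dotE _ _ H1) (@rk_dotE _ _ H2) ker1 ker2).
- move=> s.
  exact: (lincomb_norm_le s (@rk_dotE _ _ H2) (@rk_dotE _ _ H1) ker2 ker1).
exists T; split=> //.
  by exists `|Num.sqrt K| => f; rewrite !rnormE -rmorphM lecR.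
exists (fun=> 1), phi; split=> //.
by move=> y; rewrite rmorph1 scale1r Tk.
Qed.

Theorem theorem7p7 (R : realType) (d : nat) (a b : nat -> R)
    (H1 : rkhs R (hardy_domain d a))
    (H2 : rkhs R (hardy_domain d b)) :
  weighted_hardy H1 -> weighted_hardy H2 ->
  (exists C c gamma : R, [/\ 0 < C, 0 < c, 0 < gamma &
     forall n : nat, c <= b n / a n * gamma ^+ n <= C]) ->
  rkhs_isomorphic H1 H2.
Proof.
move=> wh1 wh2 [C [c [gamma [C0 c0 g0 bounds]]]].
have gena := wh_generating wh1; have genb := wh_generating wh2.
have a0 n : 0 < a n by case: gena.
have b0 n : 0 < b n by case: genb.
have baC n : b n * gamma ^+ n <= C * a n.
  have /andP[_] := bounds n.
  by rewrite mulrAC ler_pdivrMr.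
have abc n : a n <= c^-1 * (b n * gamma ^+ n).
  have /andP[+ _] := bounds n.
  by rewrite mulrAC ler_pdivlMr// -ler_pdivlMl.
have abc' n : a n * gamma^-1 ^+ n <= c^-1 * b n.
  by rewrite exprVn ler_pdivrMr ?exprn_gt0// -mulrA.
have dil z (hz : hardy_domain d a z) :=
  hardy_domain_dilation gena genb g0 baC hz.
have gV0 : 0 < gamma^-1 by rewrite invr_gt0.
have dil' z (hz : hardy_domain d b z) :=
  hardy_domain_dilation genb gena gV0 abc' hz.
pose phi (z : hardy_domain d a) : hardy_domain d b :=
  SigSub (mem_set (dil _ (set_valP z))).
pose psi (z : hardy_domain d b) : hardy_domain d a :=
  SigSub (mem_set (dil' _ (set_valP z))).
have sqrtg0 : Num.sqrt gamma != 0 by rewrite sqrtr_eq0 -ltNge.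
have phi_bij : bijective phi.
  exists psi => z; apply/val_inj; rewrite /= scalerA -rmorphM sqrtrV ?ltW//.
    by rewrite mulVf// rmorph1 scale1r.
  by rewrite mulfV// rmorph1 scale1r.
(* The kernel of [H2] at dilated points has coefficients [b_n gamma^n] in terms
   of the original points. *)
apply: (@rkhs_isomorphic_of_kernel _ d _ _ H1 H2 val phi a
  (fun n => b n * gamma ^+ n) C c^-1) => //.
- move=> z w; rewrite -rk_vecE; exact: (wh_kernel wh1).
- move=> z w /=; rewrite -rk_vecE.
  have -> : (fun n => (b n * gamma ^+ n)%:C%C * cdot (val w) (val z) ^+ n) =
      (fun n => (b n)%:C%C * cdot (val (phi w)) (val (phi z)) ^+ n).
    apply/funext => n; rewrite cdotZ sqr_sqrtr ?ltW//.
    by rewrite rmorphM rmorphXn exprMn mulrA.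
  exact: (wh_kernel wh2).
- exact: ltW.
- by rewrite invr_ge0 ltW.
Qed.
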